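(* Let $P$ be a poset with no infinite antichain. Then the following are equivalent: (i) $P$ is bqo; (ii) $(P;\leq_{succ})$ is bqo; (iii) $(P;\leq_{pred})$ is bqo; (iv) $(P;\leq_{crit})$ is bqo; (v) $AM(P)$ is bqo.
   Context: For $a,b\in P$: $a\leq_{pred} b$ iff every $x\in P$ with $x<a$ satisfies $x<b$; $a\leq_{succ} b$ iff every $y\in P$ with $b<y$ satisfies $a<y$; $a\leq_{crit} b$ iff both $a\leq_{pred} b$ and $a\leq_{succ} b$. These are quasi-orders on $P$. $AM(P)$ is the set of maximal antichains of $P$, ordered by domination: $X\leq Y$ iff for every $x\in X$ there is $y\in Y$ with $x\leq y$. Barriers and bqo: finite subsets of $\mathbb{N}$ are identified with their increasing enumerations. For finite $s,t\subseteq\mathbb{N}$ write $s\triangleleft t$ if there is a finite $r\subseteq\mathbb{N}$ such that $s$ is a proper initial segment of $r$ and $t$ is $r$ with its least element removed. A barrier is an infinite set $B$ of finite subsets of $\mathbb{N}$, no member of which is a proper subset of another, such that every infinite $X\subseteq\bigcup B$ has a nonempty initial segment belonging to $B$. A barrier is well-ordered by the lexicographic order; its order type is the type of this well-order. A map $f$ from a barrier $B$ into a quasi-ordered set $Q$ is good if there exist $s,t\in B$ with $s\triangleleft t$ and $f(s)\leq f(t)$, and bad otherwise. For a countable ordinal $\alpha$, $Q$ is $\alpha$-bqo if every map from a barrier of order type at most $\alpha$ into $Q$ is good; $Q$ is better-quasi-ordered (bqo) if it is $\alpha$-bqo for every countable ordinal $\alpha$. *)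

(* Defs.v *)
From Stdlib Require List.
From mathcomp Require Import all_boot.
Set Implicit Arguments. Unset Strict Implicit. Unset Printing Implicit Defensive.

Definition is_poset (P : Type) (le : P -> P -> Prop) : Prop :=
  [/\ forall x, le x x,
      forall x y, le x y -> le y x -> x = y
    & forall x y z, le x y -> le y z -> le x z].

Definition lt_of (P : Type) (le : P -> P -> Prop) (x y : P) : Prop :=
  le x y /\ x <> y.

Definition le_pred (P : Type) (le : P -> P -> Prop) (a b : P) : Prop :=
  forall x, lt_of le x a -> lt_of le x b.

Definition le_succ (P : Type) (le : P -> P -> Prop) (a b : P) : Prop :=
  forall y, lt_of le b y -> lt_of le a y.

Definition le_crit (P : Type) (le : P -> P -> Prop) (a b : P) : Prop :=
  le_pred le a b /\ le_succ le a b.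

Definition antichain (P : Type) (le : P -> P -> Prop) (A : P -> Prop) : Prop :=
  forall x y, A x -> A y -> le x y -> x = y.

Definition infinite_set (P : Type) (A : P -> Prop) : Prop :=
  ~ (exists l : seq P, forall x, A x -> List.In x l).

Definition no_infinite_antichain (P : Type) (le : P -> P -> Prop) : Prop :=
  forall A : P -> Prop, antichain le A -> ~ infinite_set A.

Definition maximal_antichain (P : Type) (le : P -> P -> Prop) (X : P -> Prop) : Prop :=
  antichain le X /\
  forall Y : P -> Prop, antichain le Y -> (forall x, X x -> Y x) -> (forall y, Y y -> X y).

Definition AM (P : Type) (le : P -> P -> Prop) : Type :=
  { X : P -> Prop | maximal_antichain le X }.

Definition AM_le (P : Type) (le : P -> P -> Prop) (X Y : AM le) : Prop :=
  forall x, proj1_sig X x -> exists2 y, proj1_sig Y y & le x y.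

(* A finite subset of nat is identified with its increasing enumeration,
   i.e. a seq nat sorted by ltn. *)

Definition tri (s t : seq nat) : Prop :=
  exists r : seq nat, [/\ sorted ltn r, prefix s r, s != r & t = behead r].

Definition barrier (B : seq nat -> Prop) : Prop :=
  [/\
      forall s, B s -> sorted ltn s,
      ~ (exists l : seq (seq nat), forall s, B s -> s \in l),
      (forall s t, B s -> B t -> {subset s <= t} -> s = t)
    & (* every infinite X subset of \bigcup B (enumerated increasingly by f)
         has a nonempty initial segment in B *)
      forall f : nat -> nat, (forall n, f n < f n.+1) ->
        (forall n, exists s, B s /\ f n \in s) ->
        exists k, 0 < k /\ B (mkseq f k)].

Definition good (Q : Type) (R : Q -> Q -> Prop) (B : seq nat -> Prop)
  (f : seq nat -> Q) : Prop :=
  exists s t, [/\ B s, B t, tri s t & R (f s) (f t)].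

(* bqo: every map from every barrier is good (= alpha-bqo for all countable
   alpha, since every barrier has countable order type). *)
Definition bqo (Q : Type) (R : Q -> Q -> Prop) : Prop :=
  forall B : seq nat -> Prop, barrier B -> forall f : seq nat -> Q, good R B f.

(* Main.v *)
Require Import Defs.
From mathcomp Require Import all_boot.
From mathcomp Require Import boolp classical_sets zify.
Set Implicit Arguments. Unset Strict Implicit. Unset Printing Implicit Defensive.

(* A quasi-order is bqo iff every locally constant map F on the infinite subsets
   of nat (increasing sequences X) has some X with F X <= F (shift X), where
   [shift X] removes the least element; this form is stable under clopen Ramsey
   homogenisation and under reindexing.

   bqo for pred or succ implies bqo for le, by induction on the rank of F.  Let F
   be bad and put F_m U := F (m :: U), of smaller rank.  By induction and Ramsey,
     F (x0 x1 x3 x5 ...) <= F (x0 x2 x4 ...),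
   while homogeneity for pred or for succ excludes strict inequality, as it would
   give F Z < F (shift Z).  Hence F (m :: V), for V extracted in this way from the
   tail of X beyond m, has a value v_m unchanged when that tail is shifted; as le
   is well-quasi-ordered v_m <= v_n for some m < n, and F is not bad.

   If AM is bqo then P is well-founded, and mapping a to the antichain made of a
   and of the minimal elements incomparable to a reflects domination to pred. *)

(** * Increasing sequences, subsequences and local constancy *)

Definition incr (X : nat -> nat) : Prop := forall n, X n < X n.+1.

Definition shift (X : nat -> nat) : nat -> nat := fun n => X n.+1.

Definition scons (m : nat) (X : nat -> nat) : nat -> nat :=
  fun n => if n is k.+1 then X k else m.

Definition subr (X Y : nat -> nat) : Prop := forall i, exists j, X i = Y j.

(** The bound [b] records where a tail may start: the section at [m] lives on [seqs m.+1]. *)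
Definition seqs (b : nat) (X : nat -> nat) : Prop := incr X /\ b <= X 0.

Lemma scons_shift X : scons (X 0) (shift X) = X.
Proof. by apply: funext; case. Qed.

Lemma foldr_scons_nth X s i : i < size s -> foldr scons X s i = nth 0 s i.
Proof. by elim: s i => //= a s IH [|i] //=; apply: IH. Qed.

Lemma subr_refl X : subr X X.
Proof. by move=> i; exists i. Qed.

Lemma subr_trans Y X Z : subr X Y -> subr Y Z -> subr X Z.
Proof. by move=> XY YZ i; have [j ->] := XY i; apply: YZ. Qed.

Lemma subr_comp X g : subr (X \o g) X.
Proof. by move=> i; exists (g i). Qed.

Lemma subr_shift X : subr (shift X) X.
Proof. by move=> i; exists i.+1. Qed.

Lemma incr_lt X i j : incr X -> i < j -> X i < X j.
Proof. by move=> iX; apply: (homo_ltn ltn_trans iX). Qed.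

Lemma incr_le X i j : incr X -> i <= j -> X i <= X j.
Proof. by move=> iX; rewrite leq_eqVlt => /orP[/eqP-> //|/(incr_lt iX)/ltnW]. Qed.

Lemma incr_lt_inv X i j : incr X -> X i < X j -> i < j.
Proof. by move=> iX; rewrite !ltnNge; apply: contra; apply: incr_le. Qed.

Lemma incr_ge X i : incr X -> i <= X i.
Proof. by move=> iX; elim: i => // i IH; apply: leq_ltn_trans IH (iX i). Qed.

Lemma incr_comp X Y : incr X -> incr Y -> incr (X \o Y).
Proof. by move=> iX iY n; exact: incr_lt iX (iY n). Qed.

Lemma incr_shift X : incr X -> incr (shift X).
Proof. by move=> iX n; apply: iX. Qed.

Lemma incr_tail X k : incr X -> incr (fun j => X (k + j)).
Proof. by move=> iX n; rewrite addnS. Qed.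

Lemma incr_scons m X : incr X -> m < X 0 -> incr (scons m X).
Proof. by move=> iX mX [|n] /=. Qed.

Lemma subr_seqs b Z U : seqs b Z -> incr U -> subr U Z -> seqs b U.
Proof.
move=> [iZ bZ] iU UZ; split=> //.
by have [j ->] := UZ 0; apply: leq_trans bZ (incr_le iZ _).
Qed.

Lemma seqs_scons b m X : b <= m -> seqs m.+1 X -> seqs b (scons m X).
Proof. by move=> bm [iX mX]; split=> //; apply: incr_scons. Qed.

Lemma subr_scons m X Z : subr X Z -> (exists j, m = Z j) -> subr (scons m X) Z.
Proof. by move=> XZ mZ [|i] //; apply: XZ. Qed.

(** Continuity into discrete [Q] for the pointwise topology on [seqs b]. *)
Definition loc_const (Q : Type) (b : nat) (F : (nat -> nat) -> Q) : Prop :=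
  forall X, seqs b X -> exists k, forall Y, seqs b Y ->
    (forall i, i < k -> Y i = X i) -> F Y = F X.

Definition section (Q : Type) (F : (nat -> nat) -> Q) (m : nat) :=
  fun W => F (scons m W).

Lemma loc_const_section Q b m (F : (nat -> nat) -> Q) :
  b <= m -> loc_const b F -> loc_const m.+1 (section F m).
Proof.
move=> bm lF X sX; have [k kF] := lF _ (seqs_scons bm sX).
exists k => Y sY XY; apply: kF; first exact: seqs_scons.
by case=> //= i ik; apply: XY; apply: ltnW.
Qed.

Lemma loc_const_reindex Q b g (F : (nat -> nat) -> Q) :
  incr g -> loc_const b F -> loc_const b (fun X => F (X \o g)).
Proof.
have sg X : incr g -> seqs b X -> seqs b (X \o g).
  by move=> ig [iX bX]; split; [exact: incr_comp | apply: leq_trans bX (incr_le iX _)].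
move=> ig lF X sX; have [k kF] := lF _ (sg _ ig sX).
exists (g k) => Y sY XY; apply: kF; first exact: sg.
by move=> i ik; apply: XY; apply: incr_lt.
Qed.

Lemma loc_const_restrict Q b Z (F : (nat -> nat) -> Q) :
  seqs b Z -> loc_const b F -> loc_const 0 (fun X => F (Z \o X)).
Proof.
have sZ X : seqs b Z -> seqs 0 X -> seqs b (Z \o X).
  by move=> [iZ bZ] [iX _]; split; [exact: incr_comp | apply: leq_trans bZ (incr_le iZ _)].
move=> bZ lF X sX; have [k kF] := lF _ (sZ _ bZ sX).
by exists k => Y sY XY; apply: kF => [|i /XY /= ->]; first exact: sZ.
Qed.

Lemma loc_const_shift Q b (F : (nat -> nat) -> Q) :
  loc_const b F -> loc_const b (fun X => F (shift X)).
Proof.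
have ss X : seqs b X -> seqs b (shift X).
  by move=> sX; apply: subr_seqs sX (incr_shift sX.1) (@subr_shift X).
move=> lF X sX; have [k kF] := lF _ (ss _ sX).
by exists k.+1 => Y sY XY; apply: kF => [|i ik]; [exact: ss | apply: XY].
Qed.

Lemma loc_const_op2 Q1 Q2 Q b (op : Q1 -> Q2 -> Q) (F : (nat -> nat) -> Q1)
    (G : (nat -> nat) -> Q2) :
  loc_const b F -> loc_const b G -> loc_const b (fun X => op (F X) (G X)).
Proof.
move=> lF lG X sX; have [k kF] := lF _ sX; have [l lG'] := lG _ sX.
exists (maxn k l) => Y sY XY; rewrite kF ?lG' // => i il; apply: XY; lia.
Qed.

(** * Rank induction and clopen Ramsey *)

(* Derivations play the role of the ordinal rank of a locally constant function:
   its sections have smaller rank. *)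
Inductive ranked (Q : Type) : nat -> ((nat -> nat) -> Q) -> Prop :=
| ranked_const b F :
    (forall X Y, seqs b X -> seqs b Y -> F X = F Y) -> ranked b F
| ranked_section b F :
    (forall m, b <= m -> ranked m.+1 (section F m)) -> ranked b F.

(** If [F] had no rank, heads could be chosen forever with every iterated section unranked. Local
    constancy at the sequence [X] of these heads makes some iterated section constant, hence
    ranked. *)
Lemma loc_const_ranked Q b (F : (nat -> nat) -> Q) : loc_const b F -> ranked b F.
Proof.
move=> lF; apply: contrapT => nF.
pose F_ (s : seq nat) W := F (foldr scons W s).
(* A state is the current bound with the heads chosen so far. *)
have /choice[g gP] (bs : nat * seq nat) : exists m, ~ ranked bs.1 (F_ bs.2) ->
    bs.1 <= m /\ ~ ranked m.+1 (F_ (rcons bs.2 m)).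
  have [r|nr] := pselect (ranked bs.1 (F_ bs.2)); first by exists 0.
  apply: contrapT => /forallNP H; apply: nr; apply: ranked_section => m bm.
  apply: contrapT => nr; apply: (H m) => _; split=> //.
  suff -> : F_ (rcons bs.2 m) = section (F_ bs.2) m by [].
  by apply: funext => W; rewrite /F_ /section foldr_rcons.
pose st n := iter n (fun bs => ((g bs).+1, rcons bs.2 (g bs))) (b, [::]).
have stP n : ~ ranked (st n).1 (F_ (st n).2).
  by elim: n => // n IH /=; apply: (gP (st n) IH).2.
pose X n := g (st n).
have X0 : b <= X 0 := (gP (st 0) (stP 0)).1.
have iX : incr X by move=> n; apply: (gP (st n.+1) (stP n.+1)).1.
have [k kF] := lF X (conj iX X0).
apply: (stP k); apply: ranked_const.
suff H W : seqs (st k).1 W -> F_ (st k).2 W = F X by move=> Y Z /H-> /H->.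
have st2 n : (st n).2 = mkseq X n by elim: n => //= n ->; rewrite mkseqS.
have preW n V : seqs (st n).1 V -> seqs b (foldr scons V (st n).2).
  elim: n V => [//|n IH] V /= sV; rewrite foldr_rcons; apply: IH.
  by apply: seqs_scons => //; apply: (gP (st n) (stP n)).1.
move=> sW; apply: kF => [|i ik]; first exact: preW.
by rewrite st2 foldr_scons_nth ?size_mkseq // nth_mkseq.
Qed.

(** Fusion: refine the tail repeatedly, each time for the current head, and collect the heads. Those
    after position [i] all lie in the refinement made for the [i]-th head, and [P] is hereditary. *)
Lemma diagonal (P : nat -> (nat -> nat) -> Prop) (b : nat) :
  (forall m Y U, P m Y -> incr U -> subr U Y -> P m U) ->
  (forall m Z, b <= m -> seqs m.+1 Z -> exists Y, [/\ incr Y, subr Y Z & P m Y]) ->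
  forall Z, seqs b Z -> exists Y, [/\ incr Y, subr Y Z
    & forall i, P (Y i) (fun j => Y (i.+1 + j))].
Proof.
move=> Pmono Pex Z sZ.
have /choice[g gP] (Y : nat -> nat) : exists V, seqs b Y ->
    [/\ incr V, subr V (shift Y) & P (Y 0) V].
  have [[iY bY]|?] := pselect (seqs b Y); last by exists Y.
  have [|V VP] := Pex _ (shift Y) bY; last by exists V.
  by split; [exact: incr_shift | exact: iY].
pose Zs n := iter n g Z.
have sZs n : seqs b (Zs n).
  elim: n => //= n IH; have [iV VS _] := gP _ IH.
  exact: subr_seqs IH iV (subr_trans VS (@subr_shift _)).
have Zsub n k : subr (Zs (n + k)) (Zs n).
  elim: k => [|k IH]; first by rewrite addn0; apply: subr_refl.
  rewrite addnS; have [_ VS _] := gP _ (sZs (n + k)).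
  exact: subr_trans VS (subr_trans (@subr_shift _) IH).
pose Y n := Zs n 0.
have iY : incr Y.
  move=> n; have [_ VS _] := gP _ (sZs n).
  by have [j e] := VS 0; rewrite /Y /= e; apply: incr_lt => //; case: (sZs n).
exists Y; split=> // [i|i]; first by have := Zsub 0 i; apply.
have [iV _ PV] := gP _ (sZs i); apply: Pmono PV (incr_tail _ iY) _ => j.
exact: (Zsub i.+1 j).
Qed.

Lemma pigeonhole_bool (c : nat -> bool) :
  exists e, incr e /\ exists d, forall i, c (e i) = d.
Proof.
have mk (p : nat -> bool) : (forall n, exists m, n <= m /\ p m) ->
    exists e, incr e /\ forall i, p (e i).
  move=> /choice[g gP]; exists (fun n => iter n (fun m => g m.+1) (g 0)).
  by split=> [n|[|n]] /=; [exact: (gP _).1 | exact: (gP _).2 | exact: (gP _).2].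
have [/mk[e [ie ce]]|/existsNP[n nP]] := pselect (forall n, exists m, n <= m /\ c m).
  by exists e; split=> //; exists true.
exists (fun i => n + i); split=> [i|]; first by lia.
exists false => i; apply/negbTE/negP => ci; apply: nP.
by exists (n + i); split=> //; lia.
Qed.

Lemma subr_tail_incr Y U j : incr Y -> incr U -> subr U Y -> U 0 = Y j ->
  subr (shift U) (fun i => Y (j.+1 + i)).
Proof.
move=> iY iU UY U0 i; have [l e] := UY i.+1; exists (l - j.+1).
have /(incr_lt_inv iY) jl : Y j < Y l by rewrite -U0 -e; apply: incr_lt.
by rewrite /shift e; congr Y; lia.
Qed.

(** By induction on rank each section can be made homogeneous. Diagonalising leaves a colour that
    depends only on the head, and the pigeonhole principle on heads removes this dependence. *)
Lemma ramsey b (C : (nat -> nat) -> bool) : loc_const b C ->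
  forall Z, seqs b Z -> exists Y, [/\ incr Y, subr Y Z
    & exists c, forall U, incr U -> subr U Y -> C U = c].
Proof.
move/loc_const_ranked; elim => {b C} b C IH => [Z sZ|].
  exists Z; split; [exact: sZ.1|exact: subr_refl|].
  by exists (C Z) => U iU UZ; apply: IH => //; apply: subr_seqs UZ.
move=> IHm Z sZ.
pose P m Y := exists c, forall U, incr U -> subr U Y -> C (scons m U) = c.
have [||Y [iY YZ PY]] := @diagonal P b _ _ Z sZ.
- move=> m Y U [c cP] iU UY; exists c => V iV VU; apply: cP => //.
  exact: subr_trans UY.
- move=> m {}Z bm {}sZ; exact: IHm.
have [c cP] := choice PY.
have [e [ie [d ce]]] := pigeonhole_bool c.
exists (Y \o e); split; [exact: incr_comp|exact: subr_trans (@subr_comp _ _) YZ|].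
exists d => U iU UYe; have [j Uj] := UYe 0.
rewrite -(scons_shift U) Uj /= -(ce j); apply: cP; first exact: incr_shift.
by apply: subr_tail_incr => //; apply: subr_trans UYe (@subr_comp _ _).
Qed.

(** * Functional bqo, homogeneity and well-quasi-order *)

Definition bqof (Q : Type) (R : Q -> Q -> Prop) : Prop :=
  forall F, loc_const 0 F -> exists X, incr X /\ R (F X) (F (shift X)).

Lemma loc_const_rel Q (R : Q -> Q -> Prop) b (F G : (nat -> nat) -> Q) :
  loc_const b F -> loc_const b G -> loc_const b (fun X => `[< R (F X) (G X) >]).
Proof. exact: (@loc_const_op2 _ _ _ _ (fun x y => `[< R x y >])). Qed.

(** Ramsey makes the truth of the comparison constant below [Y]; the constant is true because [bqof]
    applies to [F] transported along [Y]. *)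
Lemma bqof_homogeneous Q (R : Q -> Q -> Prop) b F Z :
  bqof R -> loc_const b F -> seqs b Z ->
  exists Y, [/\ incr Y, subr Y Z
    & forall X, incr X -> subr X Y -> R (F X) (F (shift X))].
Proof.
move=> bR lF sZ.
have [Y [iY YZ [c cP]]] := ramsey (loc_const_rel R lF (loc_const_shift lF)) sZ.
exists Y; split=> // X iX XY; apply/asboolP; rewrite (cP X) //.
have sY := subr_seqs sZ iY YZ.
have [V [iV RV]] := bR _ (loc_const_restrict sY lF).
by rewrite -(cP (Y \o V)); [apply/asboolP|exact: incr_comp|exact: subr_comp].
Qed.
(** Since strict order is transitive in a poset, this is well-foundedness, in the pairwise form that
    [bqof] delivers. *)
Definition nodesc (P : Type) (le : P -> P -> Prop) : Prop :=
  forall v : nat -> P, exists i j, i < j /\ ~ lt_of le (v j) (v i).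

Lemma loc_const_head Q (v : nat -> Q) b : loc_const b (fun X => v (X 0)).
Proof. by move=> X _; exists 1 => Y _ -> . Qed.

Lemma bqof_nodesc Q (R : Q -> Q -> Prop) P (le : P -> P -> Prop) (A : P -> Q) :
  (forall a b, R (A a) (A b) -> ~ lt_of le b a) -> bqof R -> nodesc le.
Proof.
move=> RA bR v; have [X [iX RX]] := bR _ (@loc_const_head _ (A \o v) 0).
by exists (X 0), (X 1); split; [exact: iX | exact: RA RX].
Qed.

Lemma nodesc_wqo P (le : P -> P -> Prop) : is_poset le ->
  no_infinite_antichain le -> nodesc le ->
  forall v : nat -> P, exists i j, i < j /\ le (v i) (v j).
Proof.
move=> [rfl asym trans] noanti nd v; apply: contrapT => nv.
have bad i j : i < j -> ~ le (v i) (v j) by move=> ij lij; apply: nv; exists i, j.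
pose C X := `[< le (v (X 1)) (v (X 0)) >].
have lC : loc_const 0 C.
  exact: (loc_const_rel le (loc_const_shift (@loc_const_head _ v 0)) (@loc_const_head _ v 0)).
have sid : seqs 0 id by split=> // n; exact: ltnSn.
have [Y [iY _ [c cP]]] := ramsey lC sid.
(* Ramsey for pairs: the colour sees only the first two terms, and any pair from [Y] starts some
   subsequence of [Y]. *)
have CY i j : i < j -> `[< le (v (Y j)) (v (Y i)) >] = c.
  move=> ij; pose X n := if n is n.+1 then Y (j + n) else Y i.
  have iX : incr X by move=> [|n] /=; apply: incr_lt => //; lia.
  rewrite -(cP X iX) /C /X ?addn0 // => -[|n]; by [exists i | exists (j + n)].
case: c CY {cP} => CY.
  have [i [j [ij []]]] := nd (v \o Y); split; first exact/asboolP/CY.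
  by move=> e; apply: (bad (Y i) (Y j)); [exact: incr_lt | move: e => /= ->].
(* The colour is now false, so the terms along [Y] are incomparable and distinct. A finite list
   covering them would inject [size l + 1] indices into [size l]. *)
have anti : antichain le (fun x => exists i, x = v (Y i)).
  move=> x y [i ->] [j ->] lij; have [ij|ij|-> //] := ltngtP i j.
    by case: (bad _ _ (incr_lt iY ij)).
  by have /asboolPn := CY _ _ ij.
apply: (noanti _ anti) => -[l lP].
have vI : injective (v \o Y).
  move=> i j /= e; apply/eqP; case: ltngtP => // ij; exfalso.
    by apply: (bad (Y i) (Y j)); [exact: incr_lt | rewrite e].
  by apply: (bad (Y j) (Y i)); [exact: incr_lt | rewrite e].
have [g gP] : exists g : nat -> nat, forall i, g i < size l /\ List.nth (g i) l (v 0) = v (Y i).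
  have /choice[g gP] : forall i, exists n, n < size l /\ List.nth n l (v 0) = v (Y i).
    move=> i; have [n [/ltP nl e]] := List.In_nth _ _ (v 0) (lP _ (ex_intro _ i erefl)).
    by exists n.
  by exists g.
pose h (i : 'I_(size l).+1) : 'I_(size l) := Ordinal (gP i).1.
have hI : injective h.
  move=> i j [e]; apply: val_inj; apply: vI => /=.
  by rewrite -(gP i).2 -(gP j).2 e.
by have := leq_card h hI; rewrite !card_ord ltnn.
Qed.

(** * From a wqo with the key property to bqo *)

(** Truncated predecessor gives [odds 0 = 0], so [odds] and [double] both keep the head. *)
Definition odds n := n.*2.-1.

Lemma incr_double : incr double.
Proof. by move=> n; rewrite /double; lia. Qed.

Lemma incr_odds : incr odds.
Proof. by move=> [|n]; rewrite /odds; lia. Qed.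

Lemma comp_scons g m U : g 0 = 0 -> incr g ->
  scons m U \o g = scons m (U \o (fun n => (g n.+1).-1)).
Proof.
move=> g0 ig; apply: funext => -[|n] /=; first by rewrite g0.
by case: (g n.+1) (incr_ge n.+1 ig).
Qed.

Section Collapse.
Variables (P : Type) (le : P -> P -> Prop).
Hypothesis le_poset : is_poset le.
Hypothesis le_wqo : forall v : nat -> P, exists i j, i < j /\ le (v i) (v j).

(* [X \o odds] is x0, x1, x3, x5, ... and [X \o double] is x0, x2, x4, ... *)
Hypothesis le_key : forall b (G : (nat -> nat) -> P) Z, loc_const b G -> seqs b Z ->
  (forall X, incr X -> subr X Z -> ~ le (G X) (G (shift X))) ->
  exists Y, [/\ incr Y, subr Y Z & forall X, incr X -> subr X Y ->
     ~ lt_of le (G (X \o odds)) (G (X \o double))].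

(** For bad [G], the hypothesis on heads gives [<=] and [le_key] forbids [<], so values attached to
    a head do not change when the tail is shifted; comparing two heads by [le_wqo] then contradicts
    badness. *)
Lemma collapse b (G : (nat -> nat) -> P) Z : loc_const b G -> seqs b Z ->
  (forall m V, b <= m -> seqs m.+1 V -> exists Y, [/\ incr Y, subr Y V &
     forall U, incr U -> subr U Y ->
       le (G (scons m (U \o double))) (G (scons m (shift U \o double)))]) ->
  exists X, [/\ incr X, subr X Z & le (G X) (G (shift X))].
Proof.
move=> lG sZ IH; apply: contrapT => nX.
have bad X : incr X -> subr X Z -> ~ le (G X) (G (shift X)).
  by move=> iX XZ lX; apply: nX; exists X.
have [V [iV VZ VP]] := le_key lG sZ bad.
pose Q m Y := forall U, incr U -> subr U Y ->
  le (G (scons m (U \o double))) (G (scons m (shift U \o double))).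
have [||Y [iY YV YP]] := @diagonal Q b _ _ V (subr_seqs sZ iV VZ).
- move=> m Y U QY iU UY W iW WU; apply: QY => //; exact: subr_trans UY.
- move=> m W bm sW; exact: IH.
pose tl i k := fun n => Y (i.+1 + k + n).
have itl i k : incr (tl i k) by apply: incr_tail.
have tl_sub i k : subr (tl i k) Y by move=> n; exists (i.+1 + k + n).
have inv i k : G (scons (Y i) (tl i k \o double)) = G (scons (Y i) (tl i 0 \o double)).
  elim: k => // k <-; symmetry.
  have -> : tl i k.+1 = shift (tl i k).
    by apply: funext => n; rewrite /tl /shift; congr Y; lia.
  have le_k := YP i _ (itl i k).
  have {le_k} : le (G (scons (Y i) (tl i k \o double)))
     (G (scons (Y i) (shift (tl i k) \o double))).
    by apply: le_k => n; exists (k + n); rewrite /tl; congr Y; lia.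
  move=> le_k; apply: contrapT => ne_k.
  pose X := scons (Y i) (tl i k).
  apply: (VP X).
  - apply: incr_scons => //; apply: incr_lt => //; lia.
  - by apply: subr_trans YV; apply: subr_scons => //; exists i.
  - have Xo : X \o odds = scons (Y i) (tl i k \o double).
      apply: funext => -[|n] //=; by rewrite /X /odds doubleS.
    have Xd : X \o double = scons (Y i) (shift (tl i k) \o double).
      by apply: funext => -[|n] //=; rewrite /X doubleS.
    by rewrite Xo Xd; split.
have [i [j [ij]]] := le_wqo (fun i => G (scons (Y i) (tl i 0 \o double))).
(* The shifts are chosen so that the tail attached to [Y i] becomes [Y j], [Y (j+2)], [Y (j+4)],
   ..., which is [Y j] followed by its own tail: the comparison is between a sequence and its
   shift. *)
rewrite -(inv i (j - i.+1)) -(inv j 1).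
have -> : tl i (j - i.+1) \o double = scons (Y j) (tl j 1 \o double).
  apply: funext => -[|n]; rewrite /tl /=; congr Y; lia.
have ltj : Y i < Y j by apply: incr_lt.
have := bad (scons (Y i) (scons (Y j) (tl j 1 \o double))); apply.
- apply: incr_scons => //; apply: incr_scons; last by apply: incr_lt => //; lia.
  exact: incr_comp incr_double.
- apply: (subr_trans _ (subr_trans YV VZ)).
  apply: subr_scons; last by exists i.
  apply: subr_scons; last by exists j.
  exact: subr_trans (@subr_comp _ _) (tl_sub _ _).
Qed.

(* The reindexing [g] is there for the induction: the section at [m] of
   [F (_ \o g)] along [double] is again a reindexing of the section of F. *)
Lemma ranked_good b (F : (nat -> nat) -> P) : ranked b F -> loc_const b F ->
  forall g, incr g -> g 0 = 0 -> forall Z, seqs b Z ->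
  exists X, [/\ incr X, subr X Z & le (F (X \o g)) (F (shift X \o g))].
Proof.
elim=> {b F} b F => [cF|_ IH] lF g ig g0 Z sZ.
  have sg X : seqs b X -> seqs b (X \o g).
    by move=> [iX bX]; split; [exact: incr_comp | rewrite /= g0].
  exists Z; split; [exact: sZ.1 | exact: subr_refl |].
  have [rfl _ _] := le_poset; rewrite (cF (Z \o g) (shift Z \o g)) //; apply: sg => //.
  exact: subr_seqs sZ (incr_shift sZ.1) (@subr_shift Z).
have lG := loc_const_reindex ig lF.
apply: (collapse lG sZ) => m V bm sV.
(* The section is reindexed by [2 * (g (n+1) - 1)]. Subtracting its first value [k] restores
   [g2 0 = 0]; the offset is absorbed by dropping [k] terms of [U]. *)
pose k := (g 1).-1.*2.
pose g2 n := (g n.+1).-1.*2 - k.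
have g1n n : 0 < g n.+1 by have := incr_ge n.+1 ig; lia.
have g2k n : (g n.+1).-1.*2 = k + g2 n.
  have := incr_le ig (isT : 1 <= n.+1); have := g1n 0; rewrite /g2 /k; lia.
have ig2 : incr g2.
  move=> n; have := ig n.+1; have := g2k n; have := g2k n.+1; have := g1n n; lia.
have lH := loc_const_section bm lF.
have lHg := loc_const_reindex ig2 lH.
have [Y [iY YV [c cP]]] := ramsey (loc_const_rel le lHg (loc_const_shift lHg)) sV.
(* One good sequence inside the homogeneous [Y] makes all its subsequences good. *)
have [|X [iX XY lX]] := IH m bm lH g2 ig2 _ Y (subr_seqs sV iY YV).
  by rewrite /g2 subnn.
have cT : c by rewrite -(cP X iX XY); apply/asboolP.
exists Y; split=> // U iU UY.
have eqU W : scons m (W \o double) \o g = scons m ((fun n => W (k + n)) \o g2).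
  by rewrite comp_scons //; congr scons; apply: funext => n /=; rewrite g2k.
have UkY : subr (fun n => U (k + n)) Y by apply: subr_trans UY => n; exists (k + n).
rewrite !eqU (_ : (fun n => shift U (k + n)) = shift (fun n => U (k + n))).
  by apply/asboolP; move: (cP _ (incr_tail k iU) UkY) cT => /= ->.
by apply: funext => n; rewrite /shift addnS.
Qed.

Lemma bqof_of_key : bqof le.
Proof.
move=> F lF; have iid : incr id by move=> n; exact: ltnSn.
have [X [iX _ lX]] := ranked_good (loc_const_ranked lF) lF iid erefl (conj iid isT).
by exists X.
Qed.

End Collapse.

(** * The key property from [le_pred] and from [le_succ] *)

Section PredSucc.
Variables (P : Type) (le : P -> P -> Prop).
Hypothesis le_poset : is_poset le.
Hypothesis le_noanti : no_infinite_antichain le.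

Lemma le_of_lt x y : lt_of le x y -> le x y.
Proof. by case. Qed.

Lemma lt_irrefl x : ~ lt_of le x x.
Proof. by case. Qed.

(** Both [shift X \o double] and [shift (X \o odds)] are x1, x3, x5, ..., so a strict inequality,
    pushed along [le_pred], makes [G] increase strictly from [X \o odds] to its shift. *)
Lemma bqof_of_pred : bqof (le_pred le) -> bqof le.
Proof.
move=> bR; apply: bqof_of_key => //.
  apply: nodesc_wqo => //; apply: (@bqof_nodesc _ _ _ _ id) bR => a b ab lt_ba.
  exact: lt_irrefl (ab _ lt_ba).
move=> b G Z lG sZ bad.
have lGd := loc_const_reindex incr_double lG.
have [Y [iY YZ YP]] := bqof_homogeneous bR lGd sZ.
exists Y; split=> // X iX XY /(YP X iX XY) lt_o.
apply: (bad (X \o odds)); first exact: incr_comp incr_odds.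
  exact: subr_trans (@subr_comp _ _) (subr_trans XY YZ).
exact: le_of_lt lt_o.
Qed.

Lemma bqof_of_succ : bqof (le_succ le) -> bqof le.
Proof.
move=> bR; apply: bqof_of_key => //.
  apply: nodesc_wqo => //; apply: (@bqof_nodesc _ _ _ _ id) bR => a b ab lt_ba.
  exact: lt_irrefl (ab _ lt_ba).
move=> b G Z lG sZ bad.
have lGo := loc_const_reindex incr_odds lG.
have [Y [iY YZ YP]] := bqof_homogeneous bR lGo sZ.
(* Dropping [Y 0] leaves room to prepend it: [W \o odds] is then [Y 0], x0, x2, ..., whose shift is
   [X \o double]. *)
exists (shift Y); split=> [||X iX XY lt_o]; first exact: incr_shift.
  exact: subr_trans (@subr_shift Y) YZ.
pose W := scons (Y 0) X.
have iW : incr W.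
  by apply: incr_scons => //; have [j ->] := XY 0; apply: incr_lt.
have WY : subr W Y.
  by apply: subr_scons; [exact: subr_trans XY (@subr_shift Y) | exists 0].
apply: (bad (W \o odds)); first exact: incr_comp incr_odds.
  exact: subr_trans (@subr_comp _ _) (subr_trans WY YZ).
exact: le_of_lt (YP W iW WY _ lt_o).
Qed.

End PredSucc.

(** * Barriers versus locally constant maps *)

Definition initial (s : seq nat) (X : nat -> nat) : Prop := mkseq X (size s) = s.

(** For increasing [Z], [Z n >= n], so starting past index [max s] keeps the result increasing. *)
Definition extend (Z : nat -> nat) (s : seq nat) : nat -> nat :=
  foldr scons (fun n => Z ((\max_(x <- s) x).+1 + n)) s.

Lemma take_mkseq_le (X : nat -> nat) j k : j <= k -> take j (mkseq X k) = mkseq X j.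
Proof. by move=> jk; rewrite /mkseq -map_take take_iota (minn_idPl jk). Qed.

Lemma initial_take s X k : initial s X -> initial (take k s) X.
Proof.
move=> sX; rewrite /initial size_take_min -[RHS]/(take k s) -{2}sX.
have [ks|sk] := leqP k (size s); first by rewrite take_mkseq_le.
by rewrite take_oversize // size_mkseq ltnW.
Qed.

Lemma initial_mkseq X k : initial (mkseq X k) X.
Proof. by rewrite /initial size_mkseq. Qed.

Lemma initial_shift s X : initial s X -> initial (behead s) (shift X).
Proof.
case: s => // a s [_ e].
by rewrite /initial -[RHS]e (iotaDl 1 0) -map_comp.
Qed.

Lemma eq_mkseq_agree (X Y : nat -> nat) k :
  (forall i, i < k -> Y i = X i) -> mkseq Y k = mkseq X k.
Proof.
by move=> XY; apply/eq_in_map => i; rewrite mem_iota => /andP[_]; apply: XY.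
Qed.

Lemma sorted_mkseq X k : incr X -> sorted ltn (mkseq X k).
Proof.
move=> iX; apply: (@homo_sorted _ _ X ltn ltn); last exact: iota_ltn_sorted.
by move=> i j; apply: incr_lt.
Qed.

Lemma sorted_ltn_uniq s : sorted ltn s -> uniq s.
Proof. exact: sorted_uniq ltn_trans ltnn _. Qed.

Lemma initial_extend Z s : initial s (extend Z s).
Proof.
apply: (@eq_from_nth _ 0); rewrite size_mkseq // => i si.
by rewrite nth_mkseq // /extend foldr_scons_nth.
Qed.

Lemma incr_foldr_scons W s : incr W -> sorted ltn s -> all (fun x => x < W 0) s ->
  incr (foldr scons W s).
Proof.
move=> iW; elim: s => //= a s IH ss /andP[aW sW].
apply: incr_scons; first exact: IH (path_sorted ss) sW.
by case: s ss {IH sW} => //= c s /andP[].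
Qed.

Lemma subr_foldr_scons W Z s : subr W Z -> (forall x, x \in s -> exists j, x = Z j) ->
  subr (foldr scons W s) Z.
Proof.
move=> WZ; elim: s => //= a s IH sZ.
apply: subr_scons; first by apply: IH => x xs; apply: sZ; rewrite inE xs orbT.
by apply: sZ; rewrite mem_head.
Qed.

Lemma incr_extend Z s : incr Z -> sorted ltn s -> incr (extend Z s).
Proof.
move=> iZ ss; apply: incr_foldr_scons => //; first exact: incr_tail.
apply/allP => x xs; apply: leq_trans (incr_ge _ iZ); rewrite addn0 ltnS.
exact: (@leq_bigmax_seq _ s predT id).
Qed.

Lemma subr_extend Z s : (forall x, x \in s -> exists j, x = Z j) -> subr (extend Z s) Z.
Proof.
apply: subr_foldr_scons => i.
by exists ((\max_(x <- s) x).+1 + i).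
Qed.

Lemma sorted_subset_eq s t : sorted ltn s -> sorted ltn t ->
  {subset s <= t} -> size t <= size s -> s = t.
Proof.
move=> ss st sub le_ts; apply: (irr_sorted_eq ltn_trans ltnn) => //.
by have [] := uniq_min_size (sorted_ltn_uniq ss) sub le_ts.
Qed.

Section MinimalSegments.
Variables (Q : Type) (F : (nat -> nat) -> Q).
Hypothesis lF : loc_const 0 F.

Definition determines (s : seq nat) : Prop :=
  forall X Y, incr X -> incr Y -> initial s X -> initial s Y -> F X = F Y.

(** Positive length is imposed so that a constant [F] yields singletons instead of the empty set. *)
Definition min_segment (s : seq nat) : Prop :=
  [/\ sorted ltn s, 0 < size s, determines s
    & forall k, 0 < k < size s -> ~ determines (take k s)].

Definition inclusion_minimal (s : seq nat) : Prop :=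
  forall t, min_segment t -> {subset t <= s} -> t = s.

Lemma min_segment_ex X : incr X -> exists k, min_segment (mkseq X k).
Proof.
move=> iX; have [|k kF] := lF (X := X) _; first by split.
have ex : exists k, `[< determines (mkseq X k.+1) >].
  exists k; apply/asboolP => Y Z iY iZ sY sZ.
  suff H V : incr V -> initial (mkseq X k.+1) V -> F V = F X by rewrite !H.
  move=> iV sV; apply: kF; first by split.
  move=> i ik; move: (congr1 (fun s => nth 0 s i) sV).
  by rewrite size_mkseq !nth_mkseq // ltnW.
case: (ex_minnP ex) => m /asboolP dm mmin; exists m.+1; split=> //.
  exact: sorted_mkseq.
rewrite size_mkseq => -[|j] // /andP[_ jm]; rewrite take_mkseq_le 1?ltnW // => dj.
by have := mmin j; rewrite asboolT // leqNgt -ltnS jm => /(_ isT).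
Qed.

Lemma min_segment_uniq X s t : initial s X -> initial t X ->
  min_segment s -> min_segment t -> s = t.
Proof.
wlog st : s t / size s <= size t.
  move=> H; have [/H//|/ltnW ts sX tX ms mt] := leqP (size s) (size t).
  by symmetry; apply: H.
move=> sX tX [_ s0 ds _] [_ _ _ mt].
have es : s = take (size s) t by rewrite -tX take_mkseq_le.
move: st; rewrite leq_eqVlt => /orP[/eqP e|lt_st].
  by rewrite es e take_size.
by case: (mt (size s)); [rewrite s0 | rewrite -es].
Qed.

(* Galvin's argument: by Ramsey's theorem one may assume that either all or
   none of the minimal segments are minimal for inclusion, and the latter would
   give an infinite descent on sizes. *)
Lemma inclusion_minimal_restriction : exists Z, incr Z /\
  forall s, min_segment s -> (forall x, x \in s -> exists j, x = Z j) ->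
  inclusion_minimal s.
Proof.
pose C X := `[< exists2 s, initial s X & min_segment s /\ inclusion_minimal s >].
have CE X s : initial s X -> min_segment s -> C X = `[< inclusion_minimal s >].
  move=> sX ms; apply: asbool_equiv_eq; split=> [[t tX [mt mint]]|mins]; last by exists s.
  by rewrite (min_segment_uniq sX tX ms mt).
have lC : loc_const 0 C.
  move=> X [iX _]; have [k mk] := min_segment_ex iX; exists k => Y [iY _] XY.
  have kX := initial_mkseq X k; rewrite (CE X _ kX mk); apply: CE => //.
  by rewrite /initial size_mkseq; apply: eq_mkseq_agree.
have iid : incr id by move=> n; exact: ltnSn.
have [Z [iZ _ [c cP]]] := ramsey lC (conj iid isT); exists Z; split=> //.
have cE s : min_segment s -> (forall x, x \in s -> exists j, x = Z j) ->
    `[< inclusion_minimal s >] = c.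
  move=> ms sZ; have [ss _ _ _] := ms.
  rewrite -(CE _ _ (initial_extend Z s) ms); apply: cP.
    exact: incr_extend.
  exact: subr_extend.
move=> s ms sZ; apply/asboolP; rewrite cE //.
apply: contrapT => /negP/negbTE c0; rewrite c0 in cE.
have [n] := ubnP (size s); elim: n s ms sZ => // n IH s ms sZ sn.
have /asboolPn := cE s ms sZ; apply => t mt ts.
apply: sorted_subset_eq => //; [by case: mt | by case: ms |].
rewrite leqNgt; apply/negP => lts; apply: (IH t mt) => [x /ts/sZ //|].
by apply: leq_trans lts _.
Qed.

End MinimalSegments.

(** The minimal segments inside a suitable [Z] form a barrier, on which [F] is read off by extending
    each segment arbitrarily. *)
Lemma bqo_bqof Q (R : Q -> Q -> Prop) : bqo R -> bqof R.
Proof.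
move=> bR F lF; have [Z [iZ ZP]] := inclusion_minimal_restriction lF.
pose B s := min_segment F s /\ forall x, x \in s -> exists j, x = Z j.
have mkB X : incr X -> subr X Z -> exists k, B (mkseq X k).
  move=> iX XZ; have [k mk] := min_segment_ex lF iX; exists k; split=> // x.
  by case/mapP => i _ ->.
have barB : barrier B.
  split=> [s [[]]//|[l lP]|s t [ms sZ] [mt tZ] st|f fi fB].
  (* Past every first element in [l], the tail of [Z] still has a segment in [B]. *)
  - pose n := (\max_(s <- l) head 0 s).+1.
    have [|k Bk] := mkB (fun i => Z (n + i)) (incr_tail n iZ).
      by move=> i; exists (n + i).
    have kl := lP _ Bk; case: Bk => [[_ + _ _] _]; rewrite size_mkseq.
    case: k kl => // k kl _.
    have := @leq_bigmax_seq _ l predT (head 0) _ kl isT.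
    by rewrite /= addn0 leqNgt (incr_ge n iZ).
  - exact: (ZP t mt tZ).
  - have fZ : subr f Z by move=> n; have [s [[_ sZ] /sZ]] := fB n.
    have [k Bk] := mkB f fi fZ; exists k; split=> //.
    by case: Bk => [[_ + _ _] _]; rewrite size_mkseq.
have iid : incr id by move=> n; exact: ltnSn.
have [s [t [[[ss s0 ds _] _] [[st t0 dt _] _] [r [sr pre ne tr]] lst]]] :=
  bR B barB (fun s => F (extend id s)).
(* Extending the witness [r] of [tri s t] puts [s] at the start of [X] and [t] at the start of
   [shift X]. *)
pose X := extend id r; have iX : incr X := incr_extend iid sr.
have rX : initial r X := initial_extend id r.
exists X; split=> //.
rewrite (ds X (extend id s)) ?(dt (shift X) (extend id t)) //.
- exact: incr_shift.
- exact: incr_extend.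
- by rewrite tr; apply: initial_shift.
- exact: initial_extend.
- exact: incr_extend.
- by move: pre; rewrite prefixE => /eqP <-; apply: initial_take.
- exact: initial_extend.
Qed.

(** If the union of [B] were bounded by [n], [B] would be contained in the finite list of subsets of
    [{0, ..., n-1}], given by Boolean masks. *)
Lemma infinite_barrier_enum B : barrier B ->
  exists e, incr e /\ forall n, exists s, B s /\ e n \in s.
Proof.
case=> sB infB _ _.
have /choice[g gP] n : exists m, n <= m /\ exists s, B s /\ m \in s.
  apply: contrapT => /forallNP nP; apply: infB.
  exists [seq mask (m : n.-tuple bool) (iota 0 n) | m <- enum {: n.-tuple bool}].
  move=> s Bs; have lt_sn x : x \in s -> x < n.
    move=> xs; rewrite ltnNge; apply/negP => nx.
    by apply: (nP x); split=> //; exists s.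
  have es : s = [seq x <- iota 0 n | x \in s].
    apply: (irr_sorted_eq ltn_trans ltnn); first exact: sB.
      exact: sorted_filter ltn_trans _ _ (iota_ltn_sorted 0 n).
    move=> x; rewrite mem_filter mem_iota add0n andbC.
    by case xs : (x \in s); rewrite ?andbF // lt_sn.
  have /subseqP[m + em] := filter_subseq (fun x => x \in s) (iota 0 n).
  rewrite size_iota => /eqP sm; apply/mapP.
  by exists (Tuple sm); [rewrite mem_enum | rewrite /= -em].
exists (fun n => iter n (fun m => g m.+1) (g 0)).
by split=> [n|[|n]] /=; [exact: (gP _).1 | exact: (gP _).2 | exact: (gP _).2].
Qed.

Lemma bqof_bqo Q (R : Q -> Q -> Prop) : bqof R -> bqo R.
Proof.
move=> bR B barB f; have [e [ie eB]] := infinite_barrier_enum barB.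
have [sB _ incB preB] := barB.
(* [k X] is the length of the segment of [e \o X] in [B], unique as [B] is an inclusion
   antichain. *)
have /choice[k kP] X : exists k, incr X -> 0 < k /\ B (mkseq (e \o X) k).
  have [iX|nX] := pselect (incr X); last by exists 0.
  by have [k kP] := preB _ (incr_comp ie iX) (fun n => eB (X n)); exists k.
have kle X j : incr X -> B (mkseq (e \o X) j) -> k X = j.
  move=> iX Bj; have [_ Bk] := kP X iX.
  suff /(congr1 size) : mkseq (e \o X) (k X) = mkseq (e \o X) j by rewrite !size_mkseq.
  have [kj|/ltnW jk] := leqP (k X) j.
    by apply: incB => // x; rewrite -(take_mkseq_le _ kj) => /mem_take.
  by symmetry; apply: incB => // x; rewrite -(take_mkseq_le _ jk) => /mem_take.
pose F X := f (mkseq (e \o X) (k X)).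
have lF : loc_const 0 F.
  move=> X [iX _]; exists (k X) => Y [iY _] XY.
  have eXY : mkseq (e \o Y) (k X) = mkseq (e \o X) (k X).
    by apply: eq_mkseq_agree => i /XY /= ->.
  by rewrite /F (kle Y (k X)) ?eXY //; apply: (kP X iX).2.
have [X [iX RX]] := bR F lF.
have [k0 Bs] := kP X iX; have [l0 Bt] := kP _ (incr_shift iX).
move: RX; rewrite /F; set s := mkseq _ (k X) in Bs *; set t := mkseq _ (k (shift X)) in Bt *.
(* Otherwise [t] would be a proper subset of [s]. Hence the first [k (shift X) + 1] terms properly
   extend [s] and witness [tri s t]. *)
have le_kl : k X <= k (shift X).
  rewrite leqNgt; apply/negP => lk.
  have ts : {subset t <= s}.
    move=> x /mapP[i]; rewrite mem_iota add0n => /andP[_ il] ->.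
    by apply/mapP; exists i.+1 => //; rewrite mem_iota /=; lia.
  have /(congr1 size) := incB _ _ Bt Bs ts; rewrite !size_mkseq => e_lk.
  by rewrite e_lk ltnn in lk.
move=> RX; exists s, t; split=> //.
exists (mkseq (e \o X) (k (shift X)).+1); split.
- by apply: sorted_mkseq; apply: incr_comp.
- by rewrite prefixE size_mkseq take_mkseq_le // ltnW.
- by apply/eqP => /(congr1 size); rewrite !size_mkseq => e_kl; rewrite e_kl ltnn in le_kl.
- by rewrite /t /mkseq /= (iotaDl 1 0) -map_comp.
Qed.

Lemma bqof_map Q Q' (R : Q -> Q -> Prop) (R' : Q' -> Q' -> Prop) (A : Q' -> Q) :
  (forall a b, R (A a) (A b) -> R' a b) -> bqof R -> bqof R'.
Proof.
move=> RA bR F lF; have [|X [iX RX]] := bR (A \o F).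
  by move=> X sX; have [k kF] := lF X sX; exists k => Y sY XY /=; rewrite kF.
by exists X; split=> //; apply: RA.
Qed.

(** * Maximal antichains under domination *)

Section MaximalAntichains.
Variables (P : Type) (le : P -> P -> Prop).
Hypothesis le_poset : is_poset le.

(** Zorn's lemma on the sets that remain antichains once [a] is added; the empty set is one of
    them. *)
Lemma AM_containing a : exists X : AM le, proj1_sig X a.
Proof.
pose anti (X : set P) := antichain le (fun y => y = a \/ X y).
have [F Fanti Ftot|A [antiA maxA]] := @Zorn_bigcup P anti.
  move=> x y [->|[X FX Xx]] [->|[Y FY Yy]] lxy //.
  - by apply: (Fanti Y FY) => //; [left | right].
  - by apply: (Fanti X FX) => //; [right | left].
  have [XY|YX] := Ftot X Y FX FY.
    by apply: (Fanti Y FY) => //; right=> //; apply: XY.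
  by apply: (Fanti X FX) => //; right=> //; apply: YX.
have mA : maximal_antichain le (fun y => y = a \/ A y).
  split=> // Y antiY AY y Yy; apply: contrapT => ny.
  apply: (maxA Y).
    split=> [x Ax|/(_ y Yy) Ay]; first by apply: AY; right.
    by apply: ny; right.
  have aY z : z = a \/ Y z -> Y z by case=> [->|//]; apply: AY; left.
  by move=> x z /aY Yx /aY Yz; apply: antiY.
by exists (exist _ _ mA); left.
Qed.

(** If [b < a] and [A a] is dominated by [A b], then [a] lies below some [c] in [A b]; as [b <= c],
    they coincide, so [a <= b]. *)
Lemma AM_nodesc : bqof (@AM_le P le) -> nodesc le.
Proof.
have [A AP] := choice AM_containing.
apply: (@bqof_nodesc _ _ _ _ A) => a b AB [le_ba ne_ba]; apply: ne_ba.
have [rfl asym trans] := le_poset.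
have [c Bc le_ac] := AB a (AP a).
have ebc : b = c by apply: (proj2_sig (A b)).1 => //; apply: trans le_ac.
by apply: asym => //; rewrite ebc.
Qed.

Definition minimal_in (S : P -> Prop) (m : P) : Prop :=
  S m /\ forall y, S y -> le y m -> y = m.

Lemma minimal_below (S : P -> Prop) x : nodesc le -> S x ->
  exists2 m, minimal_in S m & le m x.
Proof.
have [rfl asym trans] := le_poset.
move=> nd Sx; apply: contrapT => /forallPNP nm.
have /choice[g gP] y : exists z, S y /\ le y x -> [/\ S z, le z x & lt_of le z y].
  have [[Sy le_yx]|?] := pselect (S y /\ le y x); last by exists y.
  apply: contrapT => /forallNP H; apply: (nm y) => //; split=> // z Sz le_zy.
  apply: contrapT => ne; apply: (H z) => _; split=> //; exact: trans le_yx.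
pose v n := iter n g x.
have vP n : S (v n) /\ le (v n) x.
  by elim: n => [//|n IH] /=; have [] := gP _ IH.
have [i [j [ij]]] := nd v; apply.
apply: (@homo_ltn _ v (fun a b => lt_of le b a)) ij => [b a c [ba nba] [cb ncb]|n].
  split; first exact: trans cb ba.
  by move=> e; apply: ncb; apply: asym => //; rewrite e.
by have [] := gP _ (vP n).
Qed.

Definition incomp (a y : P) : Prop := ~ le a y /\ ~ le y a.

Definition low_antichain (a y : P) : Prop := y = a \/ minimal_in (incomp a) y.

Lemma low_antichain_maximal a : nodesc le -> maximal_antichain le (low_antichain a).
Proof.
move=> nd; split=> [x y|Y antiY subY y Yy].
  case=> [->|[[nax nxa] minx]] [->|[[nay nya] miny]] // lxy.
  exact: miny.
have Ya : Y a by apply: subY; left.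
have [l|nay] := pselect (le a y); first by left; symmetry; apply: antiY.
have [l|nya] := pselect (le y a); first by left; apply: antiY.
have [m minm le_my] := minimal_below nd (conj nay nya : incomp a y).
by right; rewrite -(antiY m y) //; apply: subY; right.
Qed.

(** The only case beyond transitivity has [a] incomparable to [b], so [a = y] by minimality. An
    [x < a] cannot be above [b], nor incomparable to it, again by minimality; so [x < b]. *)
Lemma low_antichain_pred a b : (exists2 y, low_antichain b y & le a y) -> le_pred le a b.
Proof.
have [rfl asym trans] := le_poset.
move=> [y by_ le_ay] x [le_xa ne_xa].
have lt_xb : le a b -> lt_of le x b.
  move=> le_ab; split; first exact: trans le_ab.
  by move=> e; apply: ne_xa; apply: asym => //; rewrite e.
case: by_ => [ey|[[nby nyb] miny]]; first by apply: lt_xb; rewrite -ey.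
have [/lt_xb//|nab] := pselect (le a b).
have nba : ~ le b a by move=> le_ba; apply: nby; apply: trans le_ay.
have nbx : ~ le b x by move=> le_bx; apply: nba; apply: trans le_xa.
have [le_xb|nxb] := pselect (le x b).
  by split=> // e; apply: nbx; rewrite e.
have ea : a = y by apply: miny.
by case: ne_xa; rewrite ea; apply: miny => //; rewrite -ea.
Qed.

Lemma bqof_pred_of_AM : bqof (@AM_le P le) -> bqof (le_pred le).
Proof.
move=> bA; have nd := AM_nodesc bA.
pose A a : AM le := exist _ _ (low_antichain_maximal a nd).
apply: (@bqof_map _ _ _ _ A) bA => a b AB; apply: low_antichain_pred.
by apply: (AB a); left.
Qed.

(* A bad [F] would yield the bad map choosing an element of [F X] that lies
   below no element of [F (shift X)]. *)
Lemma bqof_AM : bqof le -> bqof (@AM_le P le).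
Proof.
move=> bP F lF; apply: contrapT => nF.
have witness (X Y : AM le) : ~ AM_le X Y ->
    exists x, proj1_sig X x /\ forall y, proj1_sig Y y -> ~ le x y.
  move=> nXY; apply: contrapT => /forallNP H; apply: nXY => x Xx.
  by apply: contrapT => /forallPNP nx; apply: (H x).
have bad X : incr X -> ~ AM_le (F X) (F (shift X)).
  by move=> iX RX; apply: nF; exists X.
(* Badness makes [P] inhabited; [x0] is the default for pairs that are comparable. *)
have [x0 _] := witness _ _ (bad id (fun n => ltnSn n)).
have /choice[c cP] (XY : AM le * AM le) : exists x, ~ AM_le XY.1 XY.2 ->
    proj1_sig XY.1 x /\ forall y, proj1_sig XY.2 y -> ~ le x y.
  have [?|/witness[x xP]] := pselect (AM_le XY.1 XY.2); first by exists x0.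
  by exists x.
have [X [iX leX]] := bP _ (loc_const_op2 (fun U V => c (U, V)) lF (loc_const_shift lF)).
have [_ /(_ (c (F (shift X), F (shift (shift X)))))] := cP (F X, F (shift X)) (bad X iX).
by apply=> //; apply: (cP (_, _) (bad _ (incr_shift iX))).1.
Qed.

End MaximalAntichains.

Theorem theorem1p7 (P : Type) (le : P -> P -> Prop) :
  is_poset le -> no_infinite_antichain le ->
  [/\ bqo le <-> bqo (le_succ le),
      bqo le <-> bqo (le_pred le),
      bqo le <-> bqo (le_crit le)
    & bqo le <-> bqo (@AM_le P le)].
Proof.
move=> po na; have [rfl asym trans] := po.
have sub (Q : Type) (R R' : Q -> Q -> Prop) :
    (forall a b, R a b -> R' a b) -> bqo R -> bqo R'.
  by move=> RR' bR B bB f; have [s [t [? ? ? /RR']]] := bR B bB f; exists s, t.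
have le_lt_trans a b y : le a b -> lt_of le b y -> lt_of le a y.
  move=> ab [le_by ne]; split; first exact: trans le_by.
  by move=> e; apply: ne; apply: asym => //; rewrite -e.
have lt_le_trans x a b : lt_of le x a -> le a b -> lt_of le x b.
  move=> [xa ne] ab; split; first exact: trans ab.
  by move=> e; apply: ne; apply: asym => //; rewrite e.
(* [le] is contained in [le_crit], itself contained in [le_pred] and [le_succ]; bqo passes to larger
   relations. *)
have crit a b : le a b -> le_crit le a b.
  by move=> ab; split=> [x /lt_le_trans|y /(le_lt_trans _ _ _ ab)//]; apply.
have of_pred : bqo (le_pred le) -> bqo le.
  by move=> /bqo_bqof b; apply: bqof_bqo; apply: bqof_of_pred.
split; split.
- by apply: sub => a b /crit[].
- by move=> /bqo_bqof b; apply: bqof_bqo; apply: bqof_of_succ.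
- by apply: sub => a b /crit[].
- exact: of_pred.
- exact: sub.
- by move=> bc; apply: of_pred; apply: sub bc => a b [].
- by move=> /bqo_bqof b; apply: bqof_bqo; apply: bqof_AM.
- move=> /bqo_bqof b; apply: of_pred; apply: bqof_bqo; exact: bqof_pred_of_AM.
Qed.
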